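(* Let $\mathbb{K}=\mathbb{R}$ or $\mathbb{C}$, let $A\in\mathbb{K}^{m\times n}$ be a matrix of rank $r$, let $\lambda_1>\lambda_2>\cdots>\lambda_p>0$ be the distinct positive eigenvalues of $A^*A$, and let $m_i=\dim\{v\in\mathbb{K}^n\mid A^*Av=\lambda_iv\}$ for $i=1,\ldots,p$. If $$A=U\Sigma V^*=\overline{U}\,\overline{\Sigma}\,\overline{V}^*$$ are two singular value decompositions of $A$, then $\Sigma=\overline{\Sigma}$ and, writing $\sigma_1\ge\cdots\ge\sigma_r>0$ for the positive diagonal entries of $\Sigma$, there exist matrices $$Q_i\in U(m_i,\mathbb{K})\ (i=1,\ldots,p),\qquad Q_{\mathcal{N}}\in U(n-r,\mathbb{K}),\qquad Q_{\mathcal{N}^*}\in U(m-r,\mathbb{K})$$ such that $$V=\overline{V}\operatorname{diag}(Q_1,\ldots,Q_p,Q_{\mathcal{N}}),$$ $$U_{:,1:r}=AV_{:,1:r}\big(\operatorname{diag}(\sigma_1,\ldots,\sigma_r)\big)^{-1},\qquad \overline{U}_{:,1:r}=A\overline{V}_{:,1:r}\big(\operatorname{diag}(\sigma_1,\ldots,\sigma_r)\big)^{-1},$$ $$U_{:,(r+1):m}=\overline{U}_{:,(r+1):m}Q_{\mathcal{N}^*},$$ where $\operatorname{diag}(Q_1,\ldots,Q_p,Q_{\mathcal{N}})$ denotes a block diagonal matrix.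
   Context: $M^*$ is the conjugate transpose. $U(d,\mathbb{K})$ is the group of $d\times d$ unitary matrices over $\mathbb{K}$ (orthogonal matrices if $\mathbb{K}=\mathbb{R}$), trivial for $d=0$. A singular value decomposition of $M\in\mathbb{K}^{m\times n}$ of rank $r$ is $M=U\Sigma V^*$ with $U\in\mathbb{K}^{m\times m}$, $V\in\mathbb{K}^{n\times n}$ unitary and $\Sigma=\operatorname{diag}(\sigma_1,\ldots,\sigma_r,0,\ldots,0)\in\mathbb{R}^{m\times n}$ with $\sigma_1\ge\cdots\ge\sigma_r>0$. $M_{:,s:t}$ is the submatrix consisting of columns $s$ to $t$ inclusive. In this statement bars denote a second decomposition, not complex conjugation. *)

(* Defs.v *)
From HB Require Import structures.
From mathcomp Require Import all_boot all_order all_algebra.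
From mathcomp Require Import reals complex.

Set Implicit Arguments.
Unset Strict Implicit.
Unset Printing Implicit Defensive.

Import Order.TTheory GRing.Theory Num.Theory.
Local Open Scope ring_scope.

Inductive base_field := BaseR | BaseC.

Definition RorC (R : realType) (k : base_field) : fieldType :=
  match k with
  | BaseR => R
  | BaseC => R[i]
  end.

Definition conjRC (R : realType) (k : base_field) :
    RorC R k -> RorC R k :=
  match k return RorC R k -> RorC R k with
  | BaseR => fun x => x
  | BaseC => fun z : R[i] => conjc z
  end.

Definition of_real (R : realType) (k : base_field) : R -> RorC R k :=
  match k return R -> RorC R k with
  | BaseR => fun x => x
  | BaseC => fun x : R => (real_complex R x : R[i])
  end.

Definition ctranspose (R : realType) (k : base_field) (m n : nat)
    (M : 'M[RorC R k]_(m, n)) : 'M[RorC R k]_(n, m) :=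
  map_mx (@conjRC R k) M^T.

Definition in_unitary_group (R : realType) (k : base_field) (d : nat)
    (Q : 'M[RorC R k]_d) : Prop :=
  ctranspose Q *m Q = 1%:M.

(* MathComp's [eigenspace] and [eigenvalue] are about row vectors
   (v *m M = a *: v). To speak of column vectors with M *m v = a *: v, apply
   [passmx.leigenspace] and [passmx.leigenvalue] to this map. *)
Definition col_map (K : fieldType) (n : nat) (M : 'M[K]_n) : 'End('cV[K]_n) :=
  linfun (mulmx M : 'cV[K]_n -> 'cV[K]_n).

(* Beyond its size, a sequence is read as 0 by s`_i; so this is
   diag(s_1, ..., s_r, 0, ..., 0) for s of size r <= minn m n. *)
Definition rect_diag (R : realType) (m n : nat) (s : seq R) : 'M[R]_(m, n) :=
  \matrix_(i < m, j < n) (if i == j :> nat then s`_i else 0).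

Definition singular_form (R : realType) (m n r : nat)
    (Sigma : 'M[R]_(m, n)) (sigma : r.-tuple R) : Prop :=
  [/\ sorted >=%R sigma, (forall i : 'I_r, 0 < tnth sigma i)
    & Sigma = rect_diag m n sigma].

Definition is_svd (R : realType) (k : base_field) (m n : nat)
    (A : 'M[RorC R k]_(m, n)) (U : 'M[RorC R k]_m) (Sigma : 'M[R]_(m, n))
    (V : 'M[RorC R k]_n) : Prop :=
  [/\ in_unitary_group U, in_unitary_group V,
      exists sigma : (\rank A).-tuple R, singular_form Sigma sigma
    & A = U *m map_mx (@of_real R k) Sigma *m ctranspose V].

(* Columns 1, ..., r and r + 1, ..., n in one-based numbering. *)
Definition first_cols (K : Type) (m n r : nat) (le_rn : (r <= n)%N)
    (M : 'M[K]_(m, n)) : 'M[K]_(m, r) :=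
  colsub (widen_ord le_rn) M.

Definition last_cols (K : Type) (m n r : nat) (le_rn : (r <= n)%N)
    (M : 'M[K]_(m, n)) : 'M[K]_(m, n - r) :=
  colsub (fun j => cast_ord (subnKC le_rn) (rshift r j)) M.

(* Main.v *)
Require Import Defs.
From HB Require Import structures.
From mathcomp Require Import all_boot all_order all_algebra.
From mathcomp Require Import reals complex.

Set Implicit Arguments.
Unset Strict Implicit.
Unset Printing Implicit Defensive.

Import Order.TTheory GRing.Theory Num.Theory.
Local Open Scope ring_scope.

(** Writing W = Vbar^* V, the two decompositions diagonalise the same Hermitian
matrix: A^* A = V G V^* = Vbar G Vbar^*, where G carries the squares of the
singular values padded with zeros.  Hence W commutes with G, and an entry of W
whose row and column belong to different values of G vanishes
([intertwiner_eq0]).  So the columns of V on which G takes a given value are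
combinations of the columns of Vbar on which G takes that value, the
coefficients being the corresponding diagonal block of W, which is unitary
because W is ([level_block_unitary], [colsub_level_block]).  The same argument
for A A^* = U H U^* relates the last columns of U to those of Ubar, while the
first columns of U are determined by A V = U Sigma ([svd_first_cols]).

What remains is to know G.  The dimension of the eigenspace of A^* A for a
value x is the number of diagonal entries of G equal to x
([dim_leigenspace]), so the squared singular values are the lambda_i, each
repeated m_i times; as both lists are nonincreasing, they agree entry by entry
([svd_squares]).  Applied to both decompositions, this gives Sigma = Sigmabar;
it also says that the i-th block of consecutive indices is exactly the set of
indices where G equals lambda_i ([block_index_level]), so that the unitary
blocks of W are the blocks of the announced block diagonal matrix. *)

(** * Conjugate transposes over the reals and over the complex numbers *)

Section RealOrComplex.

Variables (R : realType) (k : base_field).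
Local Notation K := (RorC R k).

Fact conjRC_is_zmod_morphism : zmod_morphism (@conjRC R k).
Proof. by case: k => // x y; apply: rmorphB. Qed.

Fact conjRC_is_monoid_morphism : monoid_morphism (@conjRC R k).
Proof. by case: k => //; split=> [|x y]; [apply: rmorph1 | apply: rmorphM]. Qed.

HB.instance Definition _ :=
  GRing.isZmodMorphism.Build K K (@conjRC R k) conjRC_is_zmod_morphism.
HB.instance Definition _ :=
  GRing.isMonoidMorphism.Build K K (@conjRC R k) conjRC_is_monoid_morphism.

Fact of_real_is_zmod_morphism : zmod_morphism (@of_real R k).
Proof. by case: k => // x y; apply: (rmorphB (real_complex R)). Qed.

Fact of_real_is_monoid_morphism : monoid_morphism (@of_real R k).
Proof.
case: k => //; split=> [|x y]; first exact: (rmorph1 (real_complex R)).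
exact: (rmorphM (real_complex R)).
Qed.

HB.instance Definition _ :=
  GRing.isZmodMorphism.Build R K (@of_real R k) of_real_is_zmod_morphism.
HB.instance Definition _ :=
  GRing.isMonoidMorphism.Build R K (@of_real R k) of_real_is_monoid_morphism.

Lemma conjRCK : involutive (@conjRC R k).
Proof. by case: k => // x; apply: conjcK. Qed.

Lemma conj_of_real (x : R) : conjRC (of_real k x) = of_real k x :> K.
Proof. by case: k => //; apply: conjc_real. Qed.

Lemma ctransposeK m n (M : 'M[K]_(m, n)) : ctranspose (ctranspose M) = M.
Proof. by apply/matrixP=> i j; rewrite !mxE conjRCK. Qed.

Lemma ctranspose_mul m n p (M : 'M[K]_(m, n)) (N : 'M[K]_(n, p)) :
  ctranspose (M *m N) = ctranspose N *m ctranspose M.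
Proof. by rewrite /ctranspose trmx_mul map_mxM. Qed.

Lemma ctranspose_mxsub m n m' n' (f : 'I_m' -> 'I_m) (g : 'I_n' -> 'I_n)
    (M : 'M[K]_(m, n)) :
  ctranspose (mxsub f g M) = mxsub g f (ctranspose M).
Proof. by rewrite /ctranspose trmx_mxsub map_mxsub. Qed.

Lemma ctranspose_real m n (M : 'M[R]_(m, n)) :
  ctranspose (map_mx (@of_real R k) M) = map_mx (@of_real R k) M^T.
Proof. by apply/matrixP=> i j; rewrite !mxE conj_of_real. Qed.

Lemma unitaryC d (Q : 'M[K]_d) : in_unitary_group Q -> Q *m ctranspose Q = 1%:M.
Proof. exact: mulmx1C. Qed.

End RealOrComplex.

(** * Unitary matrices relating two diagonalisations *)

(** Rows of N outside the image of f are zero, so only the indices in that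
image contribute to the product; injectivity counts each of them once. *)
Lemma mulmx_supported (K : fieldType) (m n q c : nat) (f : 'I_c -> 'I_n)
    (M : 'M[K]_(m, n)) (N : 'M[K]_(n, q)) :
    injective f -> (forall x j, x \notin codom f -> N x j = 0) ->
  M *m N = colsub f M *m rowsub f N.
Proof.
move=> inj_f N0; apply/matrixP=> i j; rewrite !mxE.
rewrite (bigID (mem (codom f))) /= [X in _ + X]big1 ?addr0; last first.
  by move=> x fx; rewrite N0 ?mulr0.
transitivity (\sum_(x in [set f y | y in 'I_c]) M i x * N x j).
  by apply: eq_bigl => x; apply/codomP/imsetP => -[y]; exists y.
rewrite big_imset /=; last by move=> ? ? _ _ /inj_f.
by apply: eq_bigr => y _; rewrite !mxE.
Qed.

Lemma mxsub1_inj (K : fieldType) (n c : nat) (f : 'I_c -> 'I_n) :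
  injective f -> mxsub f f 1%:M = 1%:M :> 'M[K]_c.
Proof. by move=> inj_f; apply/matrixP=> i j; rewrite !mxE inj_eq. Qed.

Section SpectralBlocks.

Variables (R : realType) (k : base_field).
Local Notation K := (RorC R k).
Local Notation real_diag d := (diag_mx (\row_j @of_real R k (d j))).

(** Blocks are cut out by listing the indices of a level set of the diagonal
in an order of choice: this treats alike the blocks of equal singular values
and the kernels, and needs no transport between dimensions. *)
Definition enumerates_level n c (d : 'I_n -> R) (a : R) (f : 'I_c -> 'I_n) :=
  injective f /\ forall x, (x \in codom f) = (d x == a).

(** Comparing the entries (i, j) of P d and d P gives
P i j * (d j - d i) = 0. *)
Lemma intertwiner_eq0 n (d : 'I_n -> R) (P : 'M[K]_n) i j :
  P *m real_diag d = real_diag d *m P -> d i != d j -> P i j = 0.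
Proof.
move=> /matrixP/(_ i j); rewrite mul_mx_diag mul_diag_mx !mxE => Pd dij.
have /eqP : P i j * of_real k (d j - d i) = 0.
  by rewrite rmorphB mulrBr Pd mulrC subrr.
rewrite mulf_eq0 fmorph_eq0 subr_eq0 [d j == _]eq_sym.
by rewrite (negPf dij) orbF => /eqP.
Qed.

Definition level_block n c (f : 'I_c -> 'I_n) (X Y : 'M[K]_n) : 'M[K]_c :=
  mxsub f f (ctranspose Y *m X).

Section LevelBlock.

Variables (n c : nat) (d : 'I_n -> R) (a : R) (f : 'I_c -> 'I_n).
Variables (X Y : 'M[K]_n).
Hypotheses (uX : in_unitary_group X) (uY : in_unitary_group Y).
Hypothesis diagXY :
  X *m real_diag d *m ctranspose X = Y *m real_diag d *m ctranspose Y.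
Hypothesis f_level : enumerates_level d a f.

(** The columns of Y^* X listed by f vanish outside the rows listed by f, as
Y^* X commutes with the diagonal matrix. *)
Lemma mulmx_level_cols m (M : 'M_(m, n)) :
  M *m colsub f (ctranspose Y *m X) = colsub f M *m level_block f X Y.
Proof.
have [inj_f fP] := f_level; set P := ctranspose Y *m X.
have Pd : P *m real_diag d = real_diag d *m P.
  have := congr1 (fun Z => ctranspose Y *m Z *m X) diagXY.
  by rewrite /= !mulmxA uY mul1mx -!mulmxA uX mulmx1.
have Pf0 x j : x \notin codom f -> colsub f P x j = 0.
  rewrite fP mxE => dx; apply: intertwiner_eq0 Pd _.
  by have := codom_f f j; rewrite fP => /eqP ->.
by rewrite (mulmx_supported M inj_f Pf0) -mxsubrc.
Qed.

Lemma colsub_level_block : colsub f X = colsub f Y *m level_block f X Y.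
Proof. by rewrite -mulmx_level_cols mulmx_colsub mulmxA unitaryC ?mul1mx. Qed.

(** A principal submatrix of a unitary matrix P is unitary once the columns of
P it meets are supported on its rows: their scalar products are then computed
inside the block. *)
Lemma level_block_unitary : in_unitary_group (level_block f X Y).
Proof.
rewrite /in_unitary_group ctranspose_mxsub mxsubcr -mulmx_level_cols -mxsub_mul.
rewrite ctranspose_mul ctransposeK -mulmxA (mulmxA Y) unitaryC // mul1mx uX.
by apply: mxsub1_inj; case: f_level.
Qed.

End LevelBlock.

(** The columns of V indexed by the level set d = a form a basis of the
eigenspace: the eigenspace is the image of the injective map given by these
columns. *)
Lemma dim_leigenspace n (d : 'I_n -> R) (V : 'M[K]_n) (a : R) :
    in_unitary_group V ->
  \dim (passmx.leigenspace (col_map (V *m real_diag d *m ctranspose V))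
          (of_real k a)) = #|[pred j | d j == a]|.
Proof.
move=> uV; set M := _ *m _; set c := #|_|.
pose f (i : 'I_c) : 'I_n := enum_val i.
have inj_f : injective f by apply: enum_val_inj.
have fP x : (x \in codom f) = (d x == a).
  apply/codomP/idP => [[i ->]|dx]; first exact: (enum_valP i).
  have dx' : x \in [pred j | d j == a] by [].
  by exists (enum_rank_in dx' x); rewrite /f enum_rankK_in.
pose phi : 'Hom('cV[K]_c, 'cV[K]_n) := linfun (mulmx (colsub f V)).
have phi_inj : lker phi == 0%VS.
  (* The rows of V^* listed by f give a left inverse. *)
  apply/lker0P; apply: (can_inj (g := mulmx (rowsub f (ctranspose V)))) => y.
  rewrite lfunE /= mulmxA -[RHS]mul1mx; congr (_ *m _).
  by rewrite -mxsub_mul uV mxsub1_inj.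
have -> : passmx.leigenspace (col_map M) (of_real k a) = limg phi.
  apply/vspaceP=> x; rewrite memv_ker add_lfunE opp_lfunE scale_lfunE.
  rewrite id_lfunE lfunE /= subr_eq0.
  apply/eqP/memv_imgP => [Mx|[y _ ->]]; last first.
    rewrite lfunE /=.
    have -> : colsub f V = V *m colsub f 1%:M by rewrite mulmx_colsub mulmx1.
    have DE : real_diag d *m colsub f 1%:M = of_real k a *: colsub f 1%:M.
      apply/matrixP=> i j; rewrite mul_diag_mx !mxE.
      have := codom_f f j; rewrite fP => /eqP <-.
      by case: eqVneq => [->|_]; rewrite ?mulr0.
    rewrite /M -!mulmxA (mulmxA (ctranspose V)) uV mul1mx (mulmxA (diag_mx _)).
    by rewrite DE -scalemxAl -scalemxAr.
  (* In the coordinates V^* x, the eigenvector equation is entrywise. *)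
  have Dy : real_diag d *m (ctranspose V *m x) =
      of_real k a *: (ctranspose V *m x).
    by rewrite scalemxAr -Mx !mulmxA uV mul1mx.
  exists (rowsub f (ctranspose V *m x)); first exact: memvf.
  rewrite lfunE /= -mulmx_supported //.
    by rewrite mulmxA unitaryC // mul1mx.
  move=> i j; rewrite fP => di.
  have /eqP : of_real k (d i - a) * (ctranspose V *m x) i j = 0.
    move/matrixP/(_ i j): Dy; rewrite mul_diag_mx !mxE => Dy.
    by rewrite rmorphB mulrBl Dy subrr.
  by rewrite mulf_eq0 fmorph_eq0 subr_eq0 (negPf di) => /eqP.
by rewrite limg_dim_eq ?(eqP phi_inj) ?capv0 // dimvf /dim /= muln1.
Qed.

End SpectralBlocks.

(** * Gram matrices and first columns of a singular value decomposition *)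

Section SingularValues.

Lemma rect_diag_gram (R : realType) m n (s : seq R) : (size s <= m)%N ->
  (rect_diag m n s)^T *m rect_diag m n s = diag_mx (\row_j s`_j ^+ 2).
Proof.
move=> le_sm; apply/matrixP=> i j; rewrite !mxE.
have [lt_im|le_mi] := ltnP i m.
  rewrite (bigD1 (Ordinal lt_im)) //= big1 ?addr0 => [|x]; last first.
    by rewrite -val_eqE /= !mxE => /negPf ->; rewrite mul0r.
  rewrite !mxE /= eqxx -val_eqE.
  by case: eqVneq => [->|_]; rewrite ?mulr0 ?mulr0n // expr2.
(* Column i of the rectangular matrix is zero, and so is s`_i by default. *)
rewrite big1 => [|x _]; last first.
  rewrite !mxE; case: eqVneq => [xi|_]; rewrite ?mul0r //.
  by have := ltn_ord x; rewrite xi ltnNge le_mi.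
by rewrite nth_default ?expr0n ?mul0rn // (leq_trans le_sm).
Qed.

Variables (R : realType) (k : base_field).
Local Notation K := (RorC R k).
Local Notation real_diag d := (diag_mx (\row_j @of_real R k (d j))).
Local Notation real_mx M := (map_mx (@of_real R k) M).

(** As U^* U = 1, the left factor drops out of A^* A. *)
Lemma svd_gram m n (s : seq R) (A : 'M[K]_(m, n)) (U : 'M[K]_m) (V : 'M[K]_n) :
    (size s <= m)%N -> in_unitary_group U ->
    A = U *m real_mx (rect_diag m n s) *m ctranspose V ->
  ctranspose A *m A = V *m real_diag (fun j => s`_j ^+ 2) *m ctranspose V.
Proof.
move=> le_sm uU ->; rewrite !ctranspose_mul ctransposeK ctranspose_real.
rewrite -!mulmxA (mulmxA (ctranspose U)) uU mul1mx (mulmxA (real_mx _^T)).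
rewrite -map_mxM rect_diag_gram // map_diag_mx.
by congr (_ *m (diag_mx _ *m _)); apply/rowP=> j; rewrite !mxE.
Qed.

(** This turns statements on A^* A into statements on A A^*. *)
Lemma svd_ctranspose m n (s : seq R) (A : 'M[K]_(m, n)) (U : 'M[K]_m)
    (V : 'M[K]_n) :
    A = U *m real_mx (rect_diag m n s) *m ctranspose V ->
  ctranspose A = V *m real_mx (rect_diag n m s) *m ctranspose U.
Proof.
move=> ->; rewrite !ctranspose_mul ctransposeK ctranspose_real mulmxA.
congr (_ *m map_mx _ _ *m _); apply/matrixP=> i j; rewrite !mxE eq_sym.
by case: eqVneq => // ->.
Qed.

(** Since A V = U Sigma, the first columns of A V are those of U scaled by the
positive, hence invertible, singular values. *)
Lemma svd_first_cols m n r (s : r.-tuple R) (le_rm : (r <= m)%N)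
    (le_rn : (r <= n)%N) (A : 'M[K]_(m, n)) (U : 'M[K]_m) (V : 'M[K]_n) :
    in_unitary_group V -> (forall i, 0 < tnth s i) ->
    A = U *m real_mx (rect_diag m n s) *m ctranspose V ->
  first_cols le_rm U =
    A *m first_cols le_rn V *m
      invmx (diag_mx (\row_(i < r) of_real k (tnth s i))).
Proof.
move=> uV s_gt0 AE; set D := diag_mx _.
have D_unit : D \in unitmx.
  rewrite unitmxE det_diag unitfE; apply/prodf_neq0 => i _.
  by rewrite mxE fmorph_eq0 gt_eqF.
suff -> : A *m first_cols le_rn V = first_cols le_rm U *m D by rewrite mulmxK.
have inj_w : injective (widen_ord le_rm).
  by move=> i j /(congr1 val) /= /val_inj.
transitivity (U *m colsub (widen_ord le_rn) (real_mx (rect_diag m n s))).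
  by rewrite /first_cols !mulmx_colsub AE -[_ *m V]mulmxA uV mulmx1.
rewrite (mulmx_supported _ inj_w) => [|x j].
  congr (_ *m _); apply/matrixP=> i j; rewrite !mxE /= -val_eqE /=.
  by rewrite (tnth_nth 0); case: eqVneq => [->|_]; rewrite ?rmorph0.
move=> /codomP xP; rewrite !mxE /=.
case: eqVneq => [xj|_]; last by rewrite rmorph0.
by case: xP; exists j; apply: val_inj.
Qed.

(** The padding zeros of the diagonal are not counted because x is
positive. *)
Lemma card_level_count n (s : seq R) (x : R) : (size s <= n)%N -> 0 < x ->
  #|[pred j : 'I_n | s`_j ^+ 2 == x]| = count_mem x [seq y ^+ 2 | y <- s].
Proof.
move=> le_sn x_gt0.
have -> : #|[pred j : 'I_n | s`_j ^+ 2 == x]|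
          = count_mem x [seq s`_i ^+ 2 | i <- iota 0 n].
  by rewrite -val_enum_ord -map_comp count_map cardE size_filter enumT.
rewrite -(subnKC le_sn) iotaD map_cat count_cat.
rewrite (map_comp (fun y => y ^+ 2) (nth 0 s)) map_nth_iota0 // take_size.
rewrite [X in (_ + X)%N](_ : _ = 0%N) ?addn0 //; apply/eqP.
rewrite count_map -leqn0 leqNgt -has_count; apply/hasPn => i /=.
rewrite mem_iota => /andP[le_si _].
by rewrite nth_default // expr0n lt_eqF.
Qed.

End SingularValues.

(** * The squared singular values as eigenvalues with multiplicity *)

Lemma decreasing_inj (R : realType) (p : nat) (lambda : 'I_p -> R) :
  (forall i j : 'I_p, (i < j)%N -> lambda j < lambda i) -> injective lambda.
Proof.
move=> lambda_decr i j.
case: (ltngtP i j) => [/lambda_decr + ij|/lambda_decr + ij|/val_inj //];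
by rewrite ij ltxx.
Qed.

(** Two nonincreasing lists with the same multiplicities are equal.  The position
j of the list lies in the block [tagnat.sig1 j] of the decomposition of the
interval of length m_1 + ... + m_p into intervals of lengths m_i. *)
Lemma sorted_by_multiplicity (R : realType) (p : nat) (lambda : 'I_p -> R)
    (mult : 'I_p -> nat) (s : seq R) :
    (forall i j : 'I_p, (i < j)%N -> lambda j < lambda i) ->
    sorted >=%R s -> (forall i, count_mem (lambda i) s = mult i) ->
    (forall x, x \in s -> exists i, lambda i = x) ->
  s = [seq lambda (tagnat.sig1 j) | j <- enum 'I_(\sum_i mult i)].
Proof.
move=> lambda_decr s_sorted s_count s_sub.
have lambda_inj := decreasing_inj lambda_decr.
have ge_trans : transitive (>=%R : rel R).
  by move=> y x z /[swap]; apply: le_trans.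
apply: (sorted_eq ge_trans) => //.
- by move=> x y; rewrite andbC; apply: le_anti.
- rewrite sorted_map.
  have : sorted ltn (map val (enum 'I_(\sum_i mult i))).
    by rewrite val_enum_ord iota_ltn_sorted.
  rewrite sorted_map; apply: sub_sorted => i j /= /ltnW ij.
  have := tagnat.le_sig1 ij; rewrite leEord leq_eqVlt.
  case/orP=> [/eqP/val_inj->//|].
  by move/lambda_decr/ltW.
have count_t i : count_mem (lambda i)
    [seq lambda (tagnat.sig1 j) | j <- enum 'I_(\sum_i mult i)] = mult i.
  have inj_Rank : injective (tagnat.Rank i : 'I_(mult i) -> _).
    move=> x y /(congr1 val)/eqP.
    by rewrite tagnat.eq_Rank eqxx => /eqP/val_inj.
  rewrite count_map -[RHS]card_ord -(card_codom inj_Rank).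
  rewrite cardE size_filter enumT.
  apply: eq_count => j /=; rewrite inj_eq //.
  apply/eqP/codomP => [<-|[x ->]]; last exact: tagnat.Rank1K.
  by exists (tagnat.sig2 j); rewrite tagnat.sig2K.
apply/allP => x /=; rewrite mem_cat => /orP[/s_sub[i <-]|/mapP[j _ ->]];
by rewrite s_count count_t.
Qed.

(** The dimension of an eigenspace for a positive x is the multiplicity of x
among the squares; in particular every square is an eigenvalue. *)
Lemma svd_squares (R : realType) (k : base_field) (m n p : nat)
    (A : 'M[RorC R k]_(m, n)) (lambda : 'I_p -> R) (mult : 'I_p -> nat)
    (U : 'M[RorC R k]_m) (V : 'M[RorC R k]_n) (s : seq R) :
    (forall i j : 'I_p, (i < j)%N -> lambda j < lambda i) ->
    (forall x : R, (exists i : 'I_p, lambda i = x) <->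
       0 < x /\ passmx.leigenvalue (col_map (ctranspose A *m A)) (of_real k x)) ->
    (forall i : 'I_p, mult i =
       \dim (passmx.leigenspace (col_map (ctranspose A *m A))
               (of_real k (lambda i)))) ->
    in_unitary_group U -> in_unitary_group V ->
    (size s <= m)%N -> (size s <= n)%N ->
    sorted >=%R s -> (forall y, y \in s -> 0 < y) ->
    A = U *m map_mx (@of_real R k) (rect_diag m n s) *m ctranspose V ->
  [seq y ^+ 2 | y <- s] =
    [seq lambda (tagnat.sig1 j) | j <- enum 'I_(\sum_i mult i)].
Proof.
move=> lambda_decr lambda_eig mult_dim uU uV le_sm le_sn s_sorted s_gt0 AE.
have dimE x : 0 < x ->
    \dim (passmx.leigenspace (col_map (ctranspose A *m A)) (of_real k x))
    = count_mem x [seq y ^+ 2 | y <- s].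
  move=> x_gt0; rewrite (svd_gram le_sm uU AE) dim_leigenspace //.
  exact: card_level_count.
apply: sorted_by_multiplicity => //.
- have : {in [pred y | 0 < y] &, {homo (fun y : R => y ^+ 2) : x y / x >= y}}.
    move=> x y; rewrite !inE => x_gt0 y_gt0 le_yx.
    by rewrite lerXn2r ?nnegrE // ltW.
  by move/homo_sorted_in; apply=> //; apply/allP.
- move=> i; have [lambda_gt0 _] := (lambda_eig _).1 (ex_intro _ i erefl).
  by rewrite mult_dim dimE.
move=> _ /mapP[y ys ->]; have y2_gt0 : 0 < y ^+ 2 by rewrite exprn_gt0 ?s_gt0.
apply/lambda_eig; split=> //.
rewrite /passmx.leigenvalue -dimv_eq0 dimE // -lt0n -has_count has_pred1.
exact: (map_f (fun z => z ^+ 2)).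
Qed.

(** * The block diagonal matrix and its index blocks *)

Section Blocks.

Variables (n p c : nat) (mult : 'I_p -> nat).
Hypothesis eq_n : (\sum_(i < p) mult i + c = n)%N.

Definition block_index (i : 'I_p) (k : 'I_(mult i)) : 'I_n :=
  cast_ord eq_n (lshift c (tagnat.Rank i k)).

(** The offset r is a parameter because the last c indices appear both after a
sum of block sizes and after the rank. *)
Definition tail_index r (eq_r : (r + c = n)%N) (k : 'I_c) : 'I_n :=
  cast_ord eq_r (rshift r k).

(** Up to the cast, M and N are the concatenations of their column blocks, and
a block diagonal matrix acts on each of these separately. *)
Lemma mul_block_diag (K : fieldType) m (M N : 'M[K]_(m, n))
    (Q : forall i, 'M[K]_(mult i)) (QN : 'M[K]_c) :
    (forall i, colsub (@block_index i) M = colsub (@block_index i) N *m Q i) ->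
    colsub (tail_index eq_n) M = colsub (tail_index eq_n) N *m QN ->
  M = N *m castmx (eq_n, eq_n) (block_mx (\mxdiag_(i < p) Q i) 0 0 QN).
Proof.
have split_cols L : castmx (erefl, esym eq_n) L =
    row_mx (\mxrow_i colsub (@block_index i) L) (colsub (tail_index eq_n) L).
  apply/matrixP=> x y; rewrite castmxEsub.
  case: (split_ordP y) => z ->; rewrite ?row_mxEl ?row_mxEr !mxE cast_ord_id.
    by congr (L x _); apply: val_inj; rewrite /block_index tagnat.sig2K.
  by congr (L x _); apply: val_inj.
move=> MN_block MN_tail.
have cast_mul (L : 'M_(m, n)) B : L *m castmx (eq_n, eq_n) B =
    castmx (erefl, eq_n) (castmx (erefl, esym eq_n) L *m B).
  by move: L B; case: _ / eq_n => L B; rewrite !castmx_id.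
rewrite cast_mul split_cols mul_row_block !mulmx0 addr0 add0r mul_mxrow_mxdiag.
have -> : M = castmx (erefl, eq_n) (castmx (erefl, esym eq_n) M).
  by rewrite castmx_comp castmx_id.
by rewrite split_cols -MN_tail; congr (castmx _ (row_mx _ _)); apply/eq_mxrow.
Qed.

Variables (R : realType) (s : seq R).
Hypothesis s_gt0 : forall x, x \in s -> 0 < x.

(** The last c squares are zero by default, and the others are positive. *)
Lemma tail_index_level r (eq_r : (r + c = n)%N) : size s = r ->
  enumerates_level (fun j : 'I_n => s`_j ^+ 2) 0 (tail_index eq_r).
Proof.
move=> sz_s; split=> [x y /cast_ord_inj /rshift_inj //|x].
rewrite sqrf_eq0; have [lt_xr|le_rx] := ltnP x r.
  rewrite gt_eqF ?s_gt0 ?mem_nth ?sz_s //.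
  apply/negP=> /codomP[y xE]; move: lt_xr; rewrite xE /=.
  by rewrite ltnNge leq_addr.
rewrite nth_default ?sz_s // eqxx; apply/codomP.
have lt_xc : (x - r < c)%N by rewrite ltn_subLR // eq_r.
by exists (Ordinal lt_xc); apply: val_inj; rewrite /= subnKC.
Qed.

Variable lambda : 'I_p -> R.
Hypothesis lambda_inj : injective lambda.
Hypothesis squaresE :
  [seq y ^+ 2 | y <- s] =
    [seq lambda (tagnat.sig1 j) | j <- enum 'I_(\sum_i mult i)].

Lemma block_index_level i : 0 < lambda i ->
  enumerates_level (fun j : 'I_n => s`_j ^+ 2) (lambda i) (@block_index i).
Proof.
move=> lambda_gt0; have sz_s : size s = (\sum_i mult i)%N.
  by have /(congr1 size) := squaresE; rewrite 2!size_map size_enum_ord.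
split=> [x y /cast_ord_inj /lshift_inj /(congr1 val)/eqP|x].
  by rewrite tagnat.eq_Rank eqxx => /eqP/val_inj.
rewrite -[x](cast_ordKV eq_n).
case: (split_ordP (cast_ord (esym eq_n) x)) => y ->.
  have -> /= : s`_y ^+ 2 = lambda (tagnat.sig1 y).
    rewrite -(nth_map 0 0 (fun z => z ^+ 2)) ?sz_s // squaresE.
    by rewrite (nth_map y) ?size_enum_ord // nth_ord_enum.
  rewrite inj_eq //; apply/codomP/eqP => [[z]|<-].
    by move/cast_ord_inj/lshift_inj => ->; apply: tagnat.Rank1K.
  by exists (tagnat.sig2 y); rewrite /block_index tagnat.sig2K.
rewrite /= nth_default ?sz_s ?leq_addr // expr0n /= lt_eqF //.
by apply/negP=> /codomP[z] /cast_ord_inj /eqP; rewrite eq_rlshift.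
Qed.

End Blocks.

(** * Uniqueness of the singular value decomposition *)

Theorem corollary4p3 (R : realType) (k : base_field) (m n : nat)
    (A : 'M[RorC R k]_(m, n))
    (p : nat) (lambda : 'I_p -> R) (mult : 'I_p -> nat)
    (lambda_decr : forall i j : 'I_p, (i < j)%N -> lambda j < lambda i)
    (lambda_eig : forall x : R,
       (exists i : 'I_p, lambda i = x) <->
       0 < x /\ passmx.leigenvalue (col_map (ctranspose A *m A)) (of_real k x))
    (mult_dim : forall i : 'I_p,
       mult i =
       \dim (passmx.leigenspace (col_map (ctranspose A *m A)) (of_real k (lambda i))))
    (U Ubar : 'M[RorC R k]_m) (Sigma Sigmabar : 'M[R]_(m, n))
    (V Vbar : 'M[RorC R k]_n)
    (svd : is_svd A U Sigma V)
    (svdbar : is_svd A Ubar Sigmabar Vbar)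
    (sigma : (\rank A).-tuple R)
    (sigma_Sigma : singular_form Sigma sigma) :
  let r := \rank A in
  let le_rm : (r <= m)%N := rank_leq_row A in
  let le_rn : (r <= n)%N := rank_leq_col A in
  let D : 'M[RorC R k]_r :=
    diag_mx (\row_(i < r) of_real k (tnth sigma i)) in
  Sigma = Sigmabar /\
  exists (Q : forall i : 'I_p, 'M[RorC R k]_(mult i))
         (QN : 'M[RorC R k]_(n - r)) (QNs : 'M[RorC R k]_(m - r))
         (eq_n : (\sum_(i < p) mult i + (n - r) = n)%N),
    [/\ forall i : 'I_p, in_unitary_group (Q i), in_unitary_group QN & in_unitary_group QNs] /\
    [/\ V = Vbar *m castmx (eq_n, eq_n)
                      (block_mx (\mxdiag_(i < p) Q i) 0 0 QN),
        first_cols le_rm U = A *m first_cols le_rn V *m invmx D,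
        first_cols le_rm Ubar = A *m first_cols le_rn Vbar *m invmx D
      & last_cols le_rm U = last_cols le_rm Ubar *m QNs].
Proof.
move=> r le_rm le_rn D.
case: svd => uU uV _ AE.
case: svdbar => uUbar uVbar [sigmabar sigmabar_Sigma] AEbar.
case: sigma_Sigma => sorted_s s_gt0 SigmaE.
case: sigmabar_Sigma => sorted_t t_gt0 SigmabarE.
have mem_gt0 (t : r.-tuple R) : (forall i, 0 < tnth t i) ->
    forall y, y \in t -> 0 < y.
  by move=> t0 y /tnthP[i ->].
rewrite SigmaE in AE; rewrite SigmabarE in AEbar.
have sz_m (t : r.-tuple R) : (size t <= m)%N by rewrite size_tuple.
have sz_n (t : r.-tuple R) : (size t <= n)%N by rewrite size_tuple.
have sqE := svd_squares lambda_decr lambda_eig mult_dim uU uV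
  (sz_m sigma) (sz_n sigma) sorted_s (mem_gt0 _ s_gt0) AE.
have sqEbar := svd_squares lambda_decr lambda_eig mult_dim uUbar uVbar
  (sz_m sigmabar) (sz_n sigmabar) sorted_t (mem_gt0 _ t_gt0) AEbar.
have sqrt_sq (t : r.-tuple R) : (forall i, 0 < tnth t i) ->
    [seq Num.sqrt x | x <- [seq y ^+ 2 | y <- t]] = t :> seq R.
  move=> t0; rewrite -map_comp -[RHS]map_id; apply/eq_in_map => y ty /=.
  by rewrite sqrtr_sqr gtr0_norm // (mem_gt0 t).
have st : sigmabar = sigma.
  by apply: val_inj; rewrite /= -(sqrt_sq _ t_gt0) sqEbar -sqE sqrt_sq.
split; first by rewrite SigmaE SigmabarE st.
rewrite st in AEbar.
have r_mult : (\sum_(i < p) mult i)%N = r.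
  by have /(congr1 size) := sqE; rewrite 2!size_map size_enum_ord size_tuple.
have eq_n : (\sum_(i < p) mult i + (n - r) = n)%N by rewrite r_mult subnKC.
have lambda_gt0 i : 0 < lambda i.
  by have [] := (lambda_eig _).1 (ex_intro _ i erefl).
have lambda_inj := decreasing_inj lambda_decr.
have gramV := etrans (esym (svd_gram (sz_m _) uU AE))
  (svd_gram (sz_m _) uUbar AEbar).
have gramU := etrans (esym (svd_gram (sz_n _) uV (svd_ctranspose AE)))
  (svd_gram (sz_n _) uVbar (svd_ctranspose AEbar)).
have block_level i :=
  block_index_level eq_n lambda_inj sqE (lambda_gt0 i).
have tail_level := tail_index_level (mem_gt0 _ s_gt0) eq_n
  (etrans (size_tuple sigma) (esym r_mult)).
have left_level := tail_index_level (mem_gt0 _ s_gt0) (subnKC le_rm)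
  (size_tuple sigma).
exists (fun i => level_block (@block_index _ _ _ _ eq_n i) V Vbar).
exists (level_block (tail_index eq_n) V Vbar).
exists (level_block (tail_index (subnKC le_rm)) U Ubar), eq_n.
split; split.
- by move=> i; apply: level_block_unitary uV uVbar gramV (block_level i).
- exact: level_block_unitary uV uVbar gramV tail_level.
- exact: level_block_unitary uU uUbar gramU left_level.
- apply: mul_block_diag => [i|].
    exact: colsub_level_block uV uVbar gramV (block_level i).
  exact: colsub_level_block uV uVbar gramV tail_level.
- exact: svd_first_cols AE.
- exact: svd_first_cols AEbar.
- exact: colsub_level_block uU uUbar gramU left_level.
Qed.
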